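(* Let $\alpha\in[0,1)$ and $V_{\alpha,0}\equiv0$. For $i\in\mathbb{N}_{\ge1}$ and $q\in\{0,1\}$: (1) $V_{\alpha,n}(i,q)-V_{\alpha,n}(i-1,q)$ is non-decreasing in $n\in\mathbb{N}_0$; (2) $V_{\alpha,n}(i,q)-V_{\alpha,n}(i-1,q)$ is non-increasing in $\alpha$. As a result, the thresholds $i_{\alpha,n}$ are non-increasing in $n$ and non-decreasing in $\alpha$.
   Context: Model. Real parameters $\lambda,\beta>0$ and $0<\mu_1<\mu_2$ satisfy $\lambda+\mu_1+\mu_2+\beta=1$; service cost rates $0=c_{\mu_1}<c_{\mu_2}$; a fixed rate $\mu\in\{\mu_1,\mu_2\}$ with $\mu>\lambda$. The holding cost $h:\mathbb{N}_0\to\mathbb{R}$ satisfies $h(0)=0$, is non-negative, non-decreasing, convex (i.e. $h(i+1)-h(i)$ is non-decreasing in $i$), unbounded, and $\sum_{i\ge 0}h(i)x^i<\infty$ for all $0<x<1$. State space $S=\mathbb{N}_0\times\{0,1\}$. Write $i^+=\max\{i,0\}$. Value Iteration (with discount parameter $\alpha\in[0,1)$). $V_{\alpha,0}\equiv0$ on $S$ and, for $n\ge 0$, $i\in\mathbb{N}_0$, $$V_{\alpha,n+1}(i,1)=h(i)+(1-\alpha)\big(\mu_1V_{\alpha,n}(i,1)+\mu_1V_{\alpha,n}((i-1)^+,1)+\lambda V_{\alpha,n}(i+1,1)+\beta V_{\alpha,n}(i,0)\big)+\min_{a\in\{\mu_1,\mu_2\}}\big\{c_a+(1-\alpha)\big((a-\mu_1)V_{\alpha,n}((i-1)^+,1)+(\mu_2-a)V_{\alpha,n}(i,1)\big)\big\},$$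 $$V_{\alpha,n+1}(i,0)=c_\mu+h(i)+(1-\alpha)\big(\mu V_{\alpha,n}((i-1)^+,0)+(1-\mu-\lambda)V_{\alpha,n}(i,0)+\lambda V_{\alpha,n}(i+1,0)\big).$$ The policy $\phi_{\alpha,n+1}$ picks in $(i,1)$ the minimising action $a$ in the first formula, ties being resolved in favour of $\mu_1$; equivalently $\phi_{\alpha,n+1}(i,1)=\mu_1$ iff $V_{\alpha,n}(i,1)-V_{\alpha,n}((i-1)^+,1)\le \frac{c_{\mu_2}}{(1-\alpha)(\mu_2-\mu_1)}$. It is known that $V_{\alpha,n}(\cdot,q)$ is non-decreasing and convex, so there is a unique threshold $i_{\alpha,n}\in\mathbb{N}_0\cup\{\infty\}$ with $\phi_{\alpha,n}(i,1)=\mu_1$ for $i\le i_{\alpha,n}$ and $\phi_{\alpha,n}(i,1)=\mu_2$ for $i>i_{\alpha,n}$ ($n\ge1$); by convention $i_{\alpha,0}=\infty$. *)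

(* Defs.v *)
From Stdlib Require Import Reals ClassicalEpsilon.
From Coquelicot Require Import Coquelicot.
Local Open Scope R_scope.

(* The two available service actions, at rates mu_1 < mu_2. *)
Inductive service : Set := Slow | Fast.

Record model : Type := Model {
  lam : R;
  beta : R;
  rate : service -> R;
  cost : service -> R;
  (* the fixed service level used in the states (i, 0) *)
  fixed : service;
  hold : nat -> R;

  lam_gt0 : 0 < lam;
  beta_gt0 : 0 < beta;
  rate_gt0 : 0 < rate Slow;
  rate_lt : rate Slow < rate Fast;
  rates_sum1 : lam + rate Slow + rate Fast + beta = 1;
  cost_slow : cost Slow = 0;
  cost_fast_gt0 : 0 < cost Fast;
  fixed_gt_lam : lam < rate fixed;
  hold0 : hold 0 = 0;
  hold_ge0 : forall i, 0 <= hold i;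
  hold_nondecr : forall i, hold i <= hold (S i);
  hold_convex : forall i,
    hold (S i) - hold i <= hold (S (S i)) - hold (S i);
  hold_unbounded : forall B : R, exists i, B < hold i;
  hold_summable : forall x : R, 0 < x < 1 ->
    ex_series (fun i => hold i * x ^ i)
}.

(* A state (i, q) is given by i : nat and q : bool, with true for q = 1 and
   false for q = 0.  Since pred 0 = 0, pred i stands for (i - 1)^+. *)

(* The expression minimised over a in {mu_1, mu_2} in state (i, 1). *)
Definition action_value (M : model) (alpha : R) (v : nat -> bool -> R)
    (i : nat) (a : service) : R :=
  cost M a + (1 - alpha) * ((rate M a - rate M Slow) * v (pred i) true
                            + (rate M Fast - rate M a) * v i true).

Definition bellman (M : model) (alpha : R) (v : nat -> bool -> R)
    (i : nat) (q : bool) : R :=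
  if q then
    hold M i
    + (1 - alpha) * (rate M Slow * v i true + rate M Slow * v (pred i) true
                     + lam M * v (S i) true + beta M * v i false)
    + Rmin (action_value M alpha v i Slow) (action_value M alpha v i Fast)
  else
    cost M (fixed M) + hold M i
    + (1 - alpha) * (rate M (fixed M) * v (pred i) false
                     + (1 - rate M (fixed M) - lam M) * v i false
                     + lam M * v (S i) false).

Fixpoint V (M : model) (alpha : R) (n : nat) : nat -> bool -> R :=
  match n with
  | O => fun _ _ => 0
  | S n' => bellman M alpha (V M alpha n')
  end.

(* [policy M alpha n] is the policy phi_{alpha, n+1} in the states (i, 1);
   ties are resolved in favour of mu_1. *)
Definition policy (M : model) (alpha : R) (n i : nat) : service :=
  if Rle_dec (action_value M alpha (V M alpha n) i Slow)
             (action_value M alpha (V M alpha n) i Fast)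
  then Slow else Fast.

(* N_0 extended by infinity, the latter being None. *)
Definition natbar : Type := option nat.

Definition le_natbar (s t : natbar) : Prop :=
  match s, t with
  | _, None => True
  | None, Some _ => False
  | Some m, Some n => (m <= n)%nat
  end.

Definition is_threshold (phi : nat -> service) (t : natbar) : Prop :=
  forall i : nat,
    (le_natbar (Some i) t -> phi i = Slow) /\
    (~ le_natbar (Some i) t -> phi i = Fast).

(* The unique threshold of the policy phi_{alpha, n} for n >= 1; description
   by [epsilon] says nothing unless a threshold is shown to exist. *)
Definition threshold (M : model) (alpha : R) (n : nat) : natbar :=
  match n with
  | O => None
  | S n' => epsilon (inhabits None) (is_threshold (policy M alpha n'))
  end.

(* Main.v *)
Require Import Defs.
From Stdlib Require Import Reals Lra Lia Classical ClassicalEpsilon.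
Local Open Scope R_scope.

(** The increments [V (i, q) - V (i - 1, q)] satisfy a closed recursion: the
    minimum over the two actions contributes
    [min (d x_i) c + max 0 (d x_(i-1) - c)], with
    [d = (1 - alpha) (mu_2 - mu_1)] and [c = c_(mu_2)], to the increment at
    [i].  Hence the recursion is non-decreasing in the old increments, in
    [1 - alpha] and in the increment of the holding cost.  Starting from zero,
    all the claims (non-negativity, convexity, monotonicity in [n] and in
    [alpha]) follow by induction on [n].  Convexity gives the existence of the
    thresholds, and larger increments make the slow action optimal in fewer
    states. *)

Definition incr (M : model) (alpha : R) (n i : nat) (q : bool) : R :=
  V M alpha n i q - V M alpha n (pred i) q.

(* [x0], [x1], [x2] are the old increments at [i - 1], [i], [i + 1] in phase
   [q], and [y] is the one at [i] in phase 0; [h] is the increment of the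
   holding cost and [d = 1 - alpha]. *)
Definition incr_step (M : model) (d : R) (q : bool) (h x0 x1 x2 y : R) : R :=
  if q then
    h + d * (rate M Slow * x1 + rate M Slow * x0 + lam M * x2 + beta M * y)
    + Rmin (d * ((rate M Fast - rate M Slow) * x1)) (cost M Fast)
    + Rmax 0 (d * ((rate M Fast - rate M Slow) * x0) - cost M Fast)
  else
    h + d * (rate M (fixed M) * x0 + (1 - rate M (fixed M) - lam M) * x1
             + lam M * x2).

(** Since [pred 0 = 0], the reflection at the empty queue becomes a zero boundary value, so the
    recursion below needs no special case at the boundary. *)
Lemma incr_at0 (M : model) (alpha : R) (n : nat) (q : bool) :
  incr M alpha n 0 q = 0.
Proof. unfold incr; simpl; ring. Qed.

Lemma incr_stage0 (M : model) (alpha : R) (i : nat) (q : bool) :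
  incr M alpha 0 i q = 0.
Proof. unfold incr; simpl; ring. Qed.

(** For [q = true], both minima share the term [d * (rate M Fast - rate M Slow) * V M alpha n i
    true], where [d = 1 - alpha]. Once it is taken out, the minimum in [S i] leaves the [Rmin] term
    and the one in [i] leaves minus the [Rmax] term. *)
Lemma incr_rec (M : model) (alpha : R) (n i : nat) (q : bool) :
  incr M alpha (S n) (S i) q =
  incr_step M (1 - alpha) q (hold M (S i) - hold M i)
    (incr M alpha n i q) (incr M alpha n (S i) q) (incr M alpha n (S (S i)) q)
    (incr M alpha n (S i) false).
Proof.
  unfold incr; simpl V; unfold bellman, incr_step, action_value.
  rewrite (cost_slow M); simpl pred.
  destruct q; [| ring].
  unfold Rmin, Rmax; repeat destruct Rle_dec; lra.
Qed.

Lemma rate_fixed_bounds (M : model) :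
  0 < rate M (fixed M) /\ 0 < 1 - rate M (fixed M) - lam M.
Proof.
  pose proof (lam_gt0 M); pose proof (beta_gt0 M); pose proof (rate_gt0 M).
  pose proof (rate_lt M); pose proof (rates_sum1 M).
  destruct (fixed M); lra.
Qed.

(** All weights are non-negative, and truncation by [Rmin] or [Rmax] preserves order. The old
    increments are bounded below by 0 because the factor [d] varies too: [d * x <= d' * x'] can fail
    for negative [x]. *)
Lemma incr_step_le (M : model) (q : bool)
    (d d' h h' x0 x0' x1 x1' x2 x2' y y' : R) :
  0 <= d <= d' -> h <= h' -> 0 <= x0 <= x0' -> 0 <= x1 <= x1' ->
  0 <= x2 <= x2' -> 0 <= y <= y' ->
  incr_step M d q h x0 x1 x2 y <= incr_step M d' q h' x0' x1' x2' y'.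
Proof.
  intros Hd Hh H0 H1 H2 Hy.
  pose proof (lam_gt0 M); pose proof (beta_gt0 M); pose proof (rate_gt0 M).
  pose proof (rate_lt M); destruct (rate_fixed_bounds M).
  assert (scale : forall a x x', 0 <= a -> 0 <= x <= x' ->
            0 <= a * x <= a * x').
  { intros a x x' Ha Hx; split;
      [apply Rmult_le_pos | apply Rmult_le_compat_l]; lra. }
  assert (discount : forall x x', 0 <= x <= x' -> d * x <= d' * x').
  { intros x x' Hx; apply Rmult_le_compat; lra. }
  unfold incr_step; destruct q.
  - apply Rplus_le_compat; [apply Rplus_le_compat; [apply Rplus_le_compat |] |].
    + exact Hh.
    + apply discount.
      pose proof (scale (rate M Slow) x1 x1' ltac:(lra) H1).
      pose proof (scale (rate M Slow) x0 x0' ltac:(lra) H0).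
      pose proof (scale (lam M) x2 x2' ltac:(lra) H2).
      pose proof (scale (beta M) y y' ltac:(lra) Hy).
      lra.
    + apply Rle_min_compat_r, discount, scale; [lra | exact H1].
    + apply Rle_max_compat_l, Rplus_le_compat_r, discount, scale;
        [lra | exact H0].
  - apply Rplus_le_compat; [exact Hh |].
    apply discount.
    pose proof (scale (rate M (fixed M)) x0 x0' ltac:(lra) H0).
    pose proof (scale (1 - rate M (fixed M) - lam M) x1 x1' ltac:(lra) H1).
    pose proof (scale (lam M) x2 x2' ltac:(lra) H2).
    lra.
Qed.

(** This makes non-negativity of the increments an instance of [incr_step_le]. *)
Lemma incr_step_zero (M : model) (d : R) (q : bool) :
  incr_step M d q 0 0 0 0 0 = 0.
Proof.
  pose proof (cost_fast_gt0 M).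
  unfold incr_step, Rmin, Rmax; destruct q; repeat destruct Rle_dec; lra.
Qed.

Lemma incr_ge0 (M : model) (alpha : R) (n i : nat) (q : bool) :
  alpha <= 1 -> 0 <= incr M alpha n i q.
Proof.
  intros Ha; revert i q; induction n as [|n IH]; intros i q.
  - rewrite incr_stage0; lra.
  - destruct i as [|i]; [rewrite incr_at0; lra |].
    rewrite incr_rec, <- (incr_step_zero M (1 - alpha) q).
    pose proof (hold_nondecr M i).
    apply incr_step_le; try (split; [lra | apply IH]); lra.
Qed.

Lemma incr_convex (M : model) (alpha : R) (n i : nat) (q : bool) :
  alpha <= 1 -> incr M alpha n i q <= incr M alpha n (S i) q.
Proof.
  intros Ha; revert i q; induction n as [|n IH]; intros i q.
  - rewrite !incr_stage0; lra.
  (* At the boundary convexity is non-negativity; elsewhere the two sides are the same step with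
     arguments shifted by one state. *)
  - destruct i as [|i]; [rewrite incr_at0; apply incr_ge0, Ha |].
    rewrite !incr_rec.
    apply incr_step_le;
      first [apply hold_convex | split; [apply incr_ge0, Ha | apply IH] | lra].
Qed.

Lemma incr_stage_S (M : model) (alpha : R) (n i : nat) (q : bool) :
  alpha <= 1 -> incr M alpha n i q <= incr M alpha (S n) i q.
Proof.
  intros Ha; revert i q; induction n as [|n IH]; intros i q.
  - rewrite incr_stage0; apply incr_ge0, Ha.
  - destruct i as [|i]; [rewrite !incr_at0; lra |].
    rewrite 2!incr_rec.
    apply incr_step_le;
      try (split; [apply incr_ge0, Ha | apply IH]); lra.
Qed.

Lemma incr_stage_le (M : model) (alpha : R) (m n i : nat) (q : bool) :
  alpha <= 1 -> (m <= n)%nat -> incr M alpha m i q <= incr M alpha n i q.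
Proof.
  intros Ha; induction 1 as [|n _ IH]; [lra |].
  apply Rle_trans with (1 := IH), incr_stage_S, Ha.
Qed.

Lemma incr_discount_le (M : model) (alpha alpha' : R) (n i : nat) (q : bool) :
  alpha <= alpha' -> alpha' <= 1 ->
  incr M alpha' n i q <= incr M alpha n i q.
Proof.
  intros Ha Ha'; revert i q; induction n as [|n IH]; intros i q.
  - rewrite !incr_stage0; lra.
  - destruct i as [|i]; [rewrite !incr_at0; lra |].
    rewrite !incr_rec.
    apply incr_step_le; try (split; [apply incr_ge0, Ha' | apply IH]); lra.
Qed.

Lemma policy_slow_iff (M : model) (alpha : R) (n i : nat) :
  policy M alpha n i = Slow <->
  (1 - alpha) * ((rate M Fast - rate M Slow) * incr M alpha n i true)
    <= cost M Fast.
Proof.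
  unfold policy, action_value, incr; rewrite (cost_slow M).
  destruct Rle_dec; split; intros; try easy; lra.
Qed.

(** Stage, state and discount vary together, so that one comparison serves the existence of
    thresholds and both of their monotonicities. A larger [alpha] also shrinks the factor
    [1 - alpha] in the criterion for [Slow]. *)
Lemma policy_slow_le (M : model) (alpha alpha' : R) (m n i j : nat) :
  alpha' <= alpha <= 1 ->
  incr M alpha m i true <= incr M alpha' n j true ->
  policy M alpha' n j = Slow -> policy M alpha m i = Slow.
Proof.
  intros Ha Hincr; rewrite !policy_slow_iff; intros Hslow.
  pose proof (rate_lt M).
  pose proof (incr_ge0 M alpha m i true ltac:(lra)).
  apply Rle_trans with (2 := Hslow).
  apply Rmult_le_compat; [lra | apply Rmult_le_pos; lra | lra |].
  apply Rmult_le_compat_l; lra.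
Qed.

Lemma policy_at0 (M : model) (alpha : R) (n : nat) :
  policy M alpha n 0 = Slow.
Proof.
  apply policy_slow_iff; rewrite incr_at0.
  pose proof (cost_fast_gt0 M); lra.
Qed.

Lemma is_threshold_exists (phi : nat -> service) :
  phi 0%nat = Slow -> (forall i, phi (S i) = Slow -> phi i = Slow) ->
  exists t, is_threshold phi t.
Proof.
  intros H0 Hdown.
  assert (Hle : forall i j, (i <= j)%nat -> phi j = Slow -> phi i = Slow).
  { induction 1; auto. }
  destruct (classic (exists i, phi i <> Slow)) as [[i Hi] | Hall].
  (* Descend from a fast state until its predecessor is slow; that predecessor is the threshold.
     State 0 is slow, so the descent stops. *)
  - induction i as [|i IH]; [easy |].
    destruct (phi i) eqn:Ei; [| now apply IH].
    exists (Some i); intros j; simpl; split; intros Hj.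
    + now apply (Hle j i).
    + destruct (phi j) eqn:Ej; [| easy].
      contradict Hi; apply (Hle (S i) j); [lia | exact Ej].
  - exists None; intros i; simpl; split; [| tauto].
    intros _; apply NNPP; intros Hi; apply Hall; now exists i.
Qed.

Lemma is_threshold_le (phi psi : nat -> service) (s t : natbar) :
  is_threshold phi s -> is_threshold psi t ->
  (forall i, psi i = Slow -> phi i = Slow) -> le_natbar t s.
Proof.
  intros Hs Ht Himp.
  assert (Hle : forall i, le_natbar (Some i) t -> le_natbar (Some i) s).
  { intros i Hi; apply NNPP; intros Hn.
    pose proof (proj2 (Hs i) Hn) as Hfast.
    rewrite (Himp i (proj1 (Ht i) Hi)) in Hfast; discriminate. }
  destruct s as [s|], t as [t|]; simpl in *; auto.
  (* The case left has [s] finite and the other threshold infinite; state [S s] refutes it. *)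
  specialize (Hle (S s) I); lia.
Qed.

Lemma threshold_spec (M : model) (alpha : R) (n : nat) :
  alpha <= 1 -> is_threshold (policy M alpha n) (threshold M alpha (S n)).
Proof.
  intros Ha; unfold threshold; apply epsilon_spec, is_threshold_exists.
  - apply policy_at0.
  - intros i; apply policy_slow_le; [lra | apply incr_convex, Ha].
Qed.

Theorem proposition3p2 (M : model) :
  (forall (alpha : R) (i : nat) (q : bool) (m n : nat),
     0 <= alpha < 1 -> (1 <= i)%nat -> (m <= n)%nat ->
     V M alpha m i q - V M alpha m (i - 1)%nat q
       <= V M alpha n i q - V M alpha n (i - 1)%nat q) /\
  (forall (alpha alpha' : R) (i : nat) (q : bool) (n : nat),
     0 <= alpha -> alpha <= alpha' -> alpha' < 1 -> (1 <= i)%nat ->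
     V M alpha' n i q - V M alpha' n (i - 1)%nat q
       <= V M alpha n i q - V M alpha n (i - 1)%nat q) /\
  (forall (alpha : R) (m n : nat),
     0 <= alpha < 1 -> (m <= n)%nat ->
     le_natbar (threshold M alpha n) (threshold M alpha m)) /\
  (forall (alpha alpha' : R) (n : nat),
     0 <= alpha -> alpha <= alpha' -> alpha' < 1 ->
     le_natbar (threshold M alpha n) (threshold M alpha' n)).
Proof.
  repeat split.
  - intros alpha i q m n Ha _ Hmn; rewrite Nat.sub_1_r.
    apply (incr_stage_le M alpha m n i q); [lra | exact Hmn].
  - intros alpha alpha' i q n _ Ha Ha' _; rewrite Nat.sub_1_r.
    apply (incr_discount_le M alpha alpha' n i q); lra.
  - intros alpha m n Ha Hmn.
    (* At stage 0 the threshold is infinite by convention, hence an upper bound for all others. *)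
    destruct m as [|m]; [now destruct (threshold M alpha n) |].
    destruct n as [|n]; [lia |].
    apply (is_threshold_le (policy M alpha m) (policy M alpha n));
      [apply threshold_spec; lra .. |].
    intros i; apply policy_slow_le; [lra |].
    apply incr_stage_le; [lra | lia].
  - intros alpha alpha' n _ Ha Ha'.
    destruct n as [|n]; [exact I |].
    apply (is_threshold_le (policy M alpha' n) (policy M alpha n));
      [apply threshold_spec; lra .. |].
    intros i; apply policy_slow_le; [lra |].
    apply incr_discount_le; lra.
Qed.
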